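(* Let $r$ be a positive integer, $k\in\mathbb Z$, and $a_1,\dots,a_r$ nonzero complex numbers. Then for every integer $n\ge1$, \begin{align*} S_n^{(r,k)}(x|a_1,\dots,a_r)&=xS_{n-1}^{(r,k)}(x|a_1,\dots,a_r)+\sum_{m=1}^n\frac{(-1)^{m-1}\binom{n-1}{m-1}B_m}{m}\sum_{j=1}^r a_j^mS_{n-m}^{(r,k)}(x|a_1,\dots,a_r)\\ &\quad+\frac1nS_n^{(r+1,k-1)}(x|a_1,\dots,a_r,1)-\frac1nS_n^{(r+1,k)}(x|a_1,\dots,a_r,1), \end{align*} where $B_m$ denotes the $m$th ordinary Bernoulli number.
   Context: For an integer $k$, ${\rm Li}_k(x)=\sum_{m=1}^\infty x^m/m^k$. For $r\in\mathbb Z_{>0}$, $k\in\mathbb Z$ and nonzero complex $a_1,\dots,a_r$, the polynomials $S_n^{(r,k)}(x|a_1,\dots,a_r)$ are defined by $\frac{t^r}{\prod_{j=1}^r(e^{a_jt}-1)}\frac{{\rm Li}_k(1-e^{-t})}{1-e^{-t}}e^{xt}=\sum_{n\ge0}S_n^{(r,k)}(x|a_1,\dots,a_r)\frac{t^n}{n!}$; thus $S_n^{(r+1,k')}(x|a_1,\dots,a_r,1)$ is the same with $r+1$ parameters, $a_{r+1}=1$ and $k'$ in place of $k$. Ordinary Bernoulli numbers: $\frac{t}{e^t-1}=\sum_{n\ge0}B_n\frac{t^n}{n!}$. *)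

(* Defs.v *)
From HB Require Import structures.
From mathcomp Require Import all_boot all_order all_algebra.
From mathcomp Require Import boolp classical_sets.

Set Implicit Arguments.
Unset Strict Implicit.
Unset Printing Implicit Defensive.

Import GRing.Theory.
Local Open Scope ring_scope.

Record fps (R : Type) := Fps { fcoef :> nat -> R }.

Lemma fpsP (R : Type) (f g : fps R) : f =1 g -> f = g.
Proof. by case: f g => [f] [g] /= /funext ->. Qed.

HB.instance Definition _ (R : Type) := gen_eqMixin (fps R).
HB.instance Definition _ (R : Type) := gen_choiceMixin (fps R).

Section FpsZmodule.
Variable R : zmodType.

Let zero : fps R := Fps (fun=> 0).
Let opp (f : fps R) : fps R := Fps (fun n => - f n).
Let add (f g : fps R) : fps R := Fps (fun n => f n + g n).

Fact fps_addA : associative add.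
Proof. by move=> f g h; apply: fpsP => n /=; rewrite addrA. Qed.

Fact fps_addC : commutative add.
Proof. by move=> f g; apply: fpsP => n /=; rewrite addrC. Qed.

Fact fps_add0 : left_id zero add.
Proof. by move=> f; apply: fpsP => n /=; rewrite add0r. Qed.

Fact fps_addN : left_inverse zero opp add.
Proof. by move=> f; apply: fpsP => n /=; rewrite addNr. Qed.

HB.instance Definition _ :=
  GRing.isZmodule.Build (fps R) fps_addA fps_addC fps_add0 fps_addN.

Lemma fcoef0 n : (0 : fps R) n = 0. Proof. by []. Qed.
Lemma fcoefN (f : fps R) n : (- f) n = - f n. Proof. by []. Qed.
Lemma fcoefD (f g : fps R) n : (f + g) n = f n + g n. Proof. by []. Qed.
Lemma fcoefB (f g : fps R) n : (f - g) n = f n - g n. Proof. by []. Qed.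

End FpsZmodule.

Section FpsRing.
Variable R : comNzRingType.

Let one : fps R := Fps (fun n => (n == 0%N)%:R).
Let mul (f g : fps R) : fps R := Fps (fun n => \sum_(i < n.+1) f i * g (n - i)%N).

Let trunc N (f : fps R) : {poly R} := \poly_(i < N) f i.

Let mul_trunc N (f g : fps R) n : (n < N)%N ->
  mul f g n = (trunc N f * trunc N g)`_n.
Proof.
move=> ltnN; rewrite coefM; apply: eq_bigr => i _.
have leiN : (i < N)%N by apply: leq_ltn_trans ltnN; rewrite -ltnS.
by rewrite !coef_poly leiN (leq_ltn_trans (leq_subr _ _) ltnN).
Qed.

Fact fps_mulC : commutative mul.
Proof. by move=> f g; apply: fpsP => n; rewrite !(@mul_trunc n.+1) // mulrC. Qed.

Fact fps_mulA : associative mul.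
Proof.
move=> f g h; apply: fpsP => n.
transitivity ((trunc n.+1 f * (trunc n.+1 g * trunc n.+1 h))`_n).
  rewrite (@mul_trunc n.+1) // !coefM; apply: eq_bigr => i _; congr (_ * _).
  have ltn : (n - i < n.+1)%N by rewrite ltnS leq_subr.
  by rewrite -mul_trunc // coef_poly ltn.
rewrite mulrA (@mul_trunc n.+1) // !coefM.
apply: eq_bigr => i _; congr (_ * _).
by rewrite -mul_trunc // coef_poly ltn_ord.
Qed.

Fact fps_mul1 : left_id one mul.
Proof.
move=> f; apply: fpsP => n /=.
by rewrite big_ord_recl /= mul1r subn0 big1 ?addr0 // => i _; rewrite mul0r.
Qed.

Fact fps_mulD : left_distributive mul +%R.
Proof.
move=> f g h; apply: fpsP => n; rewrite fcoefD /= -big_split /=.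
by apply: eq_bigr => i _; rewrite mulrDl.
Qed.

Fact fps_oner_neq0 : one != 0.
Proof.
by apply/eqP => /(congr1 (fun f : fps R => f 0%N)) /eqP; rewrite /= oner_eq0.
Qed.

HB.instance Definition _ := GRing.Zmodule_isComNzRing.Build (fps R)
  fps_mulA fps_mulC fps_mul1 fps_mulD fps_oner_neq0.

Lemma fcoef1 n : (1 : fps R) n = (n == 0%N)%:R. Proof. by []. Qed.
Lemma fcoefM (f g : fps R) n : (f * g) n = \sum_(i < n.+1) f i * g (n - i)%N.
Proof. by []. Qed.

Definition fvar : fps R := Fps (fun n => (n == 1%N)%:R).

(** Substitution [f (g (t))]; it is the usual infinite sum [\sum_m f_m g^m] only
    when [g 0 = 0], in which case [g ^+ m] does not contribute below [t^m]. *)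
Definition fcomp (f g : fps R) : fps R :=
  Fps (fun n => \sum_(m < n.+1) f m * (g ^+ m) n).

(** The quotient [f / g] as the solution [q] of [g q = f], with [g 0] allowed to
    vanish. See [fdiv_unique] and [fdiv_exists] for uniqueness and existence. *)
Definition fdiv (f g : fps R) : fps R := xget 0 [set q | g * q = f]%classic.

End FpsRing.

Section FpsSeries.
Variable R : comUnitRingType.

(** [e^(u t)]; used only when all positive integers are invertible in [R]. *)
Definition fexp (u : R) : fps R := Fps (fun n => u ^+ n / n`!%:R).

(** [Li_k (t) = \sum_(m >= 1) t^m / m^k], for [k] of any sign. *)
Definition fLi (k : int) : fps R :=
  Fps (fun m => if m == 0%N then 0 else (m%:R ^ k)^-1).

End FpsSeries.

Definition bernoulli (C : fieldType) (n : nat) : C :=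
  n`!%:R * fdiv (fvar C) (fexp 1 - 1) n.

Section BarnesPolyBernoulli.
Variables (C : fieldType) (r : nat).

(** Series in [t] with coefficients in [C[x]], the variable [x] being ['X]. *)
Definition barnesS_genfun (k : int) (a : r.-tuple C) : fps {poly C} :=
  let u := 1 - fexp (-1) in
  fdiv (fvar _ ^+ r) (\prod_(j < r) (fexp (tnth a j)%:P - 1))
  * fdiv (fcomp (fLi _ k) u) u
  * fexp 'X.

Definition barnesS (k : int) (a : r.-tuple C) (n : nat) : {poly C} :=
  n`!%:R * barnesS_genfun k a n.

End BarnesPolyBernoulli.

Section FpsDivision.
Variable R : comUnitRingType.
Implicit Types f g q : fps R.

Definition fvanish f d := forall i, (i < d)%N -> f i = 0.

Lemma fcoefM_vanish f g d e n : fvanish f d -> fvanish g e -> (n <= d + e)%N ->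
  (f * g) n = if n == (d + e)%N then f d * g e else 0.
Proof.
move=> fd ge len; rewrite fcoefM; case: eqP => [->|/eqP nen].
  rewrite (bigD1 (inord d)) //= inordK ?ltnS ?leq_addr // addKn big1 ?addr0 //.
  move=> i; rewrite -val_eqE /= inordK ?ltnS ?leq_addr // neq_ltn.
  case/orP => lt; first by rewrite fd ?mul0r.
  rewrite (ge (d + e - i)%N) ?mulr0 // ltn_subLR ?ltn_add2r //.
  by rewrite -ltnS ltn_ord.
have ltn : (n < d + e)%N by rewrite ltn_neqAle nen.
rewrite big1 // => i _; case: (ltnP i d) => [/fd->|led]; first by rewrite mul0r.
rewrite (ge (n - i)%N) ?mulr0 // ltn_subLR ?(leq_trans ltn) ?leq_add2r //.
by rewrite -ltnS.
Qed.

Lemma fmul_inj g d q1 q2 : fvanish g d -> g d \is a GRing.unit ->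
  g * q1 = g * q2 -> q1 = q2.
Proof.
move=> gd gu /eqP; rewrite -subr_eq0 -mulrBr => /eqP gq.
apply/eqP; rewrite -subr_eq0; apply/eqP/fpsP; set q := q1 - q2 in gq *.
elim/ltn_ind => n IHn; apply: (mulrI gu).
have := @fcoefM_vanish g q d n (d + n) gd IHn (leqnn _).
by rewrite eqxx gq => <-; rewrite !fcoef0 mulr0.
Qed.

Lemma fdiv_unique f g d q : fvanish g d -> g d \is a GRing.unit ->
  g * q = f -> fdiv f g = q.
Proof.
move=> gd gu gq; apply: xget_unique => // q'; rewrite /= -gq.
exact: fmul_inj gd gu.
Qed.

Lemma fdiv_exists f g d : fvanish g d -> g d \is a GRing.unit ->
  fvanish f d -> g * fdiv f g = f.
Proof.
move=> gd gu fd; apply: (@xgetPex _ 0 [set q | g * q = f]%classic).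
pose next s := let n := size s in
  (f (d + n)%N - \sum_(i < n) g (d + n - i)%N * s`_i) / g d.
pose qs := fix qs n := if n is m.+1 then rcons (qs m) (next (qs m)) else [::].
have size_qs n : size (qs n) = n by elim: n => //= n IHn; rewrite size_rcons IHn.
pose q : fps R := Fps (fun n => next (qs n)).
have nth_qs n i : (i < n)%N -> (qs n)`_i = q i.
  elim: n => //= n IHn; rewrite ltnS nth_rcons size_qs leq_eqVlt.
  by case/predU1P => [->|ltin]; rewrite ?ltnn ?eqxx // ltin IHn.
exists q; apply: fpsP => m; case: (ltnP m d) => [ltmd|ledm].
  rewrite (@fcoefM_vanish g q d 0) ?addn0 ?(ltnW ltmd) // fd //.
  by rewrite ltn_eqF.
rewrite -(subnKC ledm); move: (m - d)%N => n.
rewrite mulrC fcoefM -(big_mkord predT (fun i => q i * g (d + n - i)%N)).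
rewrite (big_cat_nat (n := n.+1)) //= ?ltnS ?leq_addl //.
rewrite [X in _ + X]big_nat_cond [X in _ + X]big1 => [|i]; last first.
  rewrite andbT => /andP[ltni leid]; rewrite (gd (d + n - i)%N) ?mulr0 //.
  by rewrite ltn_subLR // (addnC d n) ltn_add2r.
rewrite addr0 big_nat_recr //= addnK /next size_qs divrK // addrC.
rewrite big_mkord.
rewrite [X in _ - X + _](eq_bigr (fun i : 'I_n => q i * g (d + n - i)%N)).
  by rewrite subrK.
by move=> i _; rewrite nth_qs // mulrC.
Qed.

Lemma fvanish_prod r (g : 'I_r -> fps R) : (forall j, g j 0%N = 0) ->
  fvanish (\prod_j g j) r /\ (\prod_j g j) r = \prod_j g j 1%N.
Proof.
elim: r g => [|r IHr] g g0; first by rewrite !big_ord0.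
rewrite !big_ord_recr.
have [//|v1 c1] := IHr (fun j => g (widen_ord (leqnSn r) j)).
have v2 : fvanish (g ord_max) 1 by case=> // _; apply: g0.
split=> [i lt|].
  rewrite (fcoefM_vanish v1 v2) ?addn1 1?ltnW // ltn_eqF //.
by rewrite (fcoefM_vanish v1 v2) ?addn1 // eqxx c1.
Qed.

Lemma fexp_coef0 (u : R) : fexp u 0 = 1.
Proof. by rewrite /= divr1. Qed.

Lemma fexp_coef1 (u : R) : fexp u 1 = u.
Proof. by rewrite /= expr1 divr1. Qed.

End FpsDivision.

(** The defining identity of the [bernoulli n] with denominators cleared. *)
Lemma bernoulliP (C : fieldType) :
  (fexp 1 - 1) * fdiv (fvar C) (fexp 1 - 1) = fvar C.
Proof.
apply: (@fdiv_exists _ _ _ 1); last by case.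
  by case=> // _; rewrite fcoefB fexp_coef0 subrr.
by rewrite fcoefB fexp_coef1 subr0 unitr1.
Qed.

(** The defining identity of the [barnesS k a n] with denominators cleared. *)
Lemma barnesS_genfunP (C : fieldType) (r : nat) (k : int) (a : r.-tuple C) :
    (forall j, tnth a j != 0) ->
  \prod_(j < r) (fexp (tnth a j)%:P - 1) * (1 - fexp (-1)) * barnesS_genfun k a
  = fvar {poly C} ^+ r * fcomp (fLi _ k) (1 - fexp (-1)) * fexp 'X.
Proof.
move=> a0; rewrite /barnesS_genfun; set P := \prod_(j < r) _; set u := 1 - _.
have [vP cP] : fvanish P r /\ P r = \prod_(j < r) (tnth a j)%:P.
  have [|v c] := fvanish_prod (g := fun j => fexp (tnth a j)%:P - 1).
    by move=> j; rewrite fcoefB fexp_coef0 subrr.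
  by split=> //; rewrite c; apply: eq_bigr => j _; rewrite fcoefB fexp_coef1 subr0.
have vt : fvanish (fvar {poly C} ^+ r) r.
  rewrite -[X in _ ^+ X]card_ord -prodr_const.
  by have [] := @fvanish_prod _ r (fun=> fvar {poly C}) (fun=> erefl).
have EP : P * fdiv (fvar _ ^+ r) P = fvar _ ^+ r.
  apply: fdiv_exists vP _ vt; rewrite cP -rmorph_prod /= poly_unitE.
  have nz : \prod_(j < r) tnth a j != 0 by apply/prodf_neq0 => j _.
  by rewrite size_polyC coefC nz eqxx unitfE.
have Eu : u * fdiv (fcomp (fLi _ k) u) u = fcomp (fLi _ k) u.
  apply: (@fdiv_exists _ _ _ 1).
  - by case=> // _; rewrite fcoefB fexp_coef0 subrr.
  - by rewrite fcoefB fexp_coef1 sub0r opprK unitr1.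
  - by case=> // _; rewrite /= big_ord_recl big_ord0 mul0r addr0.
by rewrite -[in RHS]EP -[in RHS]Eu !mulrA; congr (_ * _ * _); rewrite mulrAC.
Qed.

(* Main.v *)
(** With the Euler derivation [theta = t d/dt], the generating function
    [G = (\prod_j beta_(a_j)) Q_k e^(xt)], where [beta_b = t / (e^(b t) - 1)],
    [u = 1 - e^(-t)] and [Q_k = Li_k(u) / u], is differentiated factor by factor:
    [theta e^(xt) = x t e^(xt)], [theta beta_b = (1 + b beta_(-b)) beta_b] and
    [theta Q_k = beta_1 (Q_(k-1) - Q_k)], because [theta Li_k = Li_(k-1)] and
    [theta u = beta_1 u].  Multiplication by [beta_1] appends the parameter [1] to
    [a], and [b beta_b] is the exponential generating function of [b^n B_n].  The
    recurrence is the coefficient of [t^n] in the resulting expression for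
    [theta G]. *)
Require Import Defs.
From HB Require Import structures.
From mathcomp Require Import all_boot all_order all_algebra reals.
From mathcomp Require Import complex ring.

Set Implicit Arguments.
Unset Strict Implicit.
Unset Printing Implicit Defensive.

Import GRing.Theory.
Local Open Scope ring_scope.

Section Coefficients.
Variable R : comNzRingType.
Implicit Types (f g h : fps R) (c : R).

Lemma fcoef_sum I (s : seq I) (P : pred I) (F : I -> fps R) n :
  (\sum_(i <- s | P i) F i) n = \sum_(i <- s | P i) F i n.
Proof. exact: (big_morph (fun f : fps R => f n)). Qed.

Lemma eq_fcoefM f1 f2 g1 g2 n :
    (forall i, (i <= n)%N -> f1 i = f2 i) ->
    (forall i, (i <= n)%N -> g1 i = g2 i) ->
  (f1 * g1) n = (f2 * g2) n.
Proof.
move=> eqf eqg; rewrite !fcoefM; apply: eq_bigr => i _.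
by rewrite eqf -1?ltnS // eqg // leq_subr.
Qed.

Definition fconst c : fps R := Fps (fun n => if n == 0%N then c else 0).

Lemma fcoefCM c f n : (fconst c * f) n = c * f n.
Proof.
rewrite fcoefM big_ord_recl /= subn0 big1 ?addr0 // => i _.
by rewrite mul0r.
Qed.

Fact fconst_is_zmod_morphism : zmod_morphism fconst.
Proof. by move=> c d; apply: fpsP => -[|n] //=; rewrite subr0. Qed.

Fact fconst_is_monoid_morphism : monoid_morphism fconst.
Proof.
split=> [|c d]; apply: fpsP => n; first by case: n.
by rewrite fcoefCM; case: n => [|n] //=; rewrite mulr0.
Qed.

HB.instance Definition _ :=
  GRing.isZmodMorphism.Build R (fps R) fconst fconst_is_zmod_morphism.
HB.instance Definition _ :=
  GRing.isMonoidMorphism.Build R (fps R) fconst fconst_is_monoid_morphism.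

Lemma fcoef_varM f n : (fvar R * f) n = if n == 0%N then 0 else f n.-1.
Proof.
rewrite fcoefM; case: n => [|n]; first by rewrite big_ord1 mul0r.
rewrite big_ord_recl /= mul0r add0r big_ord_recl /= mul1r subSS subn0.
by rewrite big1 ?addr0 // => i _; rewrite mul0r.
Qed.

Lemma fcoefX_small g m i : g 0%N = 0 -> (i < m)%N -> (g ^+ m) i = 0.
Proof.
move=> g0; elim: m i => // m IHm i lt_im; rewrite exprS fcoefM.
rewrite big1 // => -[j /=]; case: j => [|j] lt_ji _; first by rewrite g0 mul0r.
by rewrite IHm ?mulr0 // ltn_subLR // addSnnS ltn_addl.
Qed.

End Coefficients.

Section EulerDerivation.
Variable R : comNzRingType.
Implicit Types (f g h : fps R) (c : R).

Definition ftheta f : fps R := Fps (fun n => n%:R * f n).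

Fact ftheta_is_zmod_morphism : zmod_morphism ftheta.
Proof. by move=> f g; apply: fpsP => n; rewrite [LHS]/= fcoefB mulrBr. Qed.

HB.instance Definition _ :=
  GRing.isZmodMorphism.Build (fps R) (fps R) ftheta ftheta_is_zmod_morphism.

Lemma fthetaC c : ftheta (fconst c) = 0.
Proof. by apply: fpsP => -[|n] /=; rewrite ?mul0r ?mulr0. Qed.

Lemma ftheta1 : ftheta 1 = 0.
Proof. by rewrite -(rmorph1 (@fconst R)) fthetaC. Qed.

Lemma ftheta_var : ftheta (fvar R) = fvar R.
Proof. by apply: fpsP => -[|[|n]] /=; rewrite ?mul0r ?mulr0 ?mulr1. Qed.

Lemma fthetaM f g : ftheta (f * g) = ftheta f * g + f * ftheta g.
Proof.
apply: fpsP => n; rewrite fcoefD !fcoefM /= -big_split /= mulr_sumr.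
apply: eq_bigr => i _; have le_in : (i <= n)%N by rewrite -ltnS.
by rewrite natrB //; ring.
Qed.

Lemma fthetaX f m : ftheta (f ^+ m) = f ^+ m.-1 * ftheta f *+ m.
Proof.
elim: m => [|m IHm]; first exact: ftheta1.
rewrite exprS fthetaM {}IHm mulrS mulrC; congr (_ + _).
by case: m => [|m]; rewrite mulrnAr ?mulr0n // mulrA -exprS.
Qed.

Lemma ftheta_prod I (s : seq I) (P : pred I) (W F : I -> fps R) :
    (forall i, P i -> ftheta (F i) = W i * F i) ->
  ftheta (\prod_(i <- s | P i) F i)
  = (\sum_(i <- s | P i) W i) * \prod_(i <- s | P i) F i.
Proof.
move=> WF; apply: (big_ind2 (fun w f => ftheta f = w * f)) => //.
  by rewrite ftheta1 mul0r.
by move=> w1 f1 w2 f2 w1E w2E; rewrite fthetaM w1E w2E; ring.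
Qed.

Definition fcomp_trunc N f g : fps R := \sum_(m < N) fconst (f m) * g ^+ m.

Lemma fcoef_comp_trunc N f g n : g 0%N = 0 -> (n < N)%N ->
  fcomp f g n = fcomp_trunc N f g n.
Proof.
move=> g0 lt_nN; rewrite fcoef_sum.
rewrite [LHS](big_ord_widen N (fun m => f m * (g ^+ m) n)) // big_mkcond.
apply: eq_bigr => m _; rewrite fcoefCM; case: ltnP => // lt_nm.
by rewrite fcoefX_small ?mulr0.
Qed.

Lemma ftheta_comp_trunc N f g :
  g * ftheta (fcomp_trunc N f g) = fcomp_trunc N (ftheta f) g * ftheta g.
Proof.
rewrite raddf_sum mulr_sumr mulr_suml; apply: eq_bigr => -[m _] _ /=.
have ->: ftheta (fconst (f m) * g ^+ m) = fconst (f m) * ftheta (g ^+ m).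
  by rewrite fthetaM fthetaC mul0r add0r.
have fthetaX_mul : g * ftheta (g ^+ m) = m%:R * (g ^+ m * ftheta g).
  by rewrite fthetaX mulrnAr mulr_natl; case: m => // m; rewrite mulrA -exprS.
by rewrite rmorphM rmorph_nat mulrCA fthetaX_mul mulrCA -!mulrA.
Qed.

Lemma ftheta_comp f g : g 0%N = 0 ->
  g * ftheta (fcomp f g) = fcomp (ftheta f) g * ftheta g.
Proof.
move=> g0; apply: fpsP => n.
have truncE h i : (i <= n)%N -> fcomp h g i = fcomp_trunc n.+1 h g i.
  by move=> le_in; apply: fcoef_comp_trunc.
transitivity ((g * ftheta (fcomp_trunc n.+1 f g)) n).
  by apply: eq_fcoefM => // i le_in; apply: congr1 (truncE _ _ le_in).
rewrite ftheta_comp_trunc; apply: eq_fcoefM => // i le_in.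
by rewrite truncE.
Qed.

End EulerDerivation.

Section Dilation.
Variables (R : comNzRingType) (c : R).
Implicit Types f g : fps R.

Definition fdilate f : fps R := Fps (fun n => c ^+ n * f n).

Fact fdilate_is_zmod_morphism : zmod_morphism fdilate.
Proof. by move=> f g; apply: fpsP => n; rewrite [LHS]/= fcoefB mulrBr. Qed.

Fact fdilate_is_monoid_morphism : monoid_morphism fdilate.
Proof.
split=> [|f g]; apply: fpsP => n.
  by case: n => [|n] /=; rewrite ?mul1r ?mulr0.
rewrite fcoefM [LHS]/= mulr_sumr; apply: eq_bigr => i _ /=.
have le_in : (i <= n)%N by rewrite -ltnS.
by rewrite -[in c ^+ n](subnKC le_in) exprD; ring.
Qed.

HB.instance Definition _ :=
  GRing.isZmodMorphism.Build (fps R) (fps R) fdilate fdilate_is_zmod_morphism.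
HB.instance Definition _ :=
  GRing.isMonoidMorphism.Build (fps R) (fps R) fdilate fdilate_is_monoid_morphism.

Lemma fdilate_var : fdilate (fvar R) = fconst c * fvar R.
Proof. by apply: fpsP => -[|[|n]]; rewrite fcoefCM /= ?mulr0. Qed.

End Dilation.

Section MapFps.
Variables (R S : comNzRingType) (h : {rmorphism R -> S}).

Definition map_fps (f : fps R) : fps S := Fps (fun n => h (f n)).

Fact map_fps_is_zmod_morphism : zmod_morphism map_fps.
Proof. by move=> f g; apply: fpsP => n; rewrite [LHS]/= rmorphB. Qed.

Fact map_fps_is_monoid_morphism : monoid_morphism map_fps.
Proof.
split=> [|f g]; apply: fpsP => n; first by rewrite [LHS]/= rmorph_nat.
rewrite fcoefM [LHS]/= rmorph_sum; apply: eq_bigr => i _.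
exact: rmorphM.
Qed.

HB.instance Definition _ :=
  GRing.isZmodMorphism.Build (fps R) (fps S) map_fps map_fps_is_zmod_morphism.
HB.instance Definition _ :=
  GRing.isMonoidMorphism.Build (fps R) (fps S) map_fps map_fps_is_monoid_morphism.

Lemma map_fps_var : map_fps (fvar R) = fvar S.
Proof. by apply: fpsP => n; rewrite [LHS]/= rmorph_nat. Qed.

End MapFps.

Section DeltaSeries.
Variable R : comUnitRingType.
Implicit Types f g q : fps R.

Definition delta_series g := g 0%N = 0 /\ g 1%N \is a GRing.unit.

Lemma fvanish1 f : f 0%N = 0 -> fvanish f 1.
Proof. by move=> f0 [|]. Qed.

Lemma delta_series_lreg g : delta_series g -> GRing.lreg g.
Proof. by case=> /fvanish1 g0 g1 q1 q2; apply: fmul_inj g0 g1. Qed.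

Lemma delta_fdiv_unique f g q : delta_series g -> g * q = f -> fdiv f g = q.
Proof. by case=> /fvanish1 g0 g1; apply: fdiv_unique g0 g1. Qed.

Lemma delta_fdivK f g : delta_series g -> f 0%N = 0 -> g * fdiv f g = f.
Proof. by case=> /fvanish1 g0 g1 /fvanish1; apply: fdiv_exists g0 g1. Qed.

Lemma fdiv_prod r (g : 'I_r -> fps R) : (forall j, delta_series (g j)) ->
  fdiv (fvar R ^+ r) (\prod_j g j) = \prod_j fdiv (fvar R) (g j).
Proof.
move=> delta_g; have [|prod_vanish prod_lead] := @fvanish_prod _ _ g.
  by move=> j; case: (delta_g j).
apply: fdiv_unique prod_vanish _ _.
  by rewrite prod_lead rpred_prod // => j _; case: (delta_g j).
rewrite -big_split /=; under eq_bigr do rewrite delta_fdivK //.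
by rewrite prodr_const card_ord.
Qed.

End DeltaSeries.

Section ExponentialAndPolylogarithm.
Variable R : comUnitRingType.
Hypothesis natS_unit : forall n, n.+1%:R \is a @GRing.unit R.

Lemma fact_unit n : n`!%:R \is a @GRing.unit R.
Proof. by case: n`! (fact_gt0 n). Qed.

Lemma bin_divr_fact n i : (i <= n)%N ->
  'C(n, i)%:R / n`!%:R = i`!%:R^-1 / (n - i)`!%:R :> R.
Proof.
move=> le_in; apply: (mulIr (fact_unit n)); rewrite divrK ?fact_unit //.
rewrite -invrM ?fact_unit // -natrM mulnC mulrC -(bin_fact le_in) natrM.
by rewrite mulrK // natrM unitrM !fact_unit.
Qed.

Lemma fexp0 : fexp 0 = 1 :> fps R.
Proof. by apply: fpsP => -[|n] /=; rewrite ?divr1 // expr0n mul0r. Qed.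

Lemma fexpD (u v : R) : fexp (u + v) = fexp u * fexp v.
Proof.
apply: fpsP => n; rewrite fcoefM /= addrC exprDn mulr_suml.
apply: eq_bigr => i _; rewrite -[_ *+ _]mulr_natr -[LHS]mulrA.
by rewrite bin_divr_fact -1?ltnS //; ring.
Qed.

Lemma fexpMN (u : R) : fexp u * fexp (- u) = 1.
Proof. by rewrite -fexpD subrr fexp0. Qed.

Lemma ftheta_fexp (u : R) : ftheta (fexp u) = fconst u * fvar R * fexp u.
Proof.
apply: fpsP => -[|n]; rewrite -mulrA fcoefCM fcoef_varM /= ?mul0r ?mulr0 //.
rewrite factS natrM invrM ?fact_unit // exprS.
by rewrite mulrC !mulrA divrK.
Qed.

Lemma ftheta_fLi (k : int) : ftheta (fLi R k) = fLi R (k - 1).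
Proof.
apply: fpsP => -[|n] /=; first by rewrite mul0r.
by rewrite exprzDr // exprN1 invrM ?unitrXz ?unitrV // invrK.
Qed.

End ExponentialAndPolylogarithm.

Section BernoulliSeries.
Variable R : comUnitRingType.
Implicit Types b c : R.

Definition fbern b : fps R := fdiv (fvar R) (fexp b - 1).

Lemma delta_fexpB1 b : b \is a GRing.unit -> delta_series (fexp b - 1).
Proof. by split; rewrite fcoefB ?fexp_coef0 ?subrr // fexp_coef1 subr0. Qed.

Lemma fbernP b : b \is a GRing.unit -> (fexp b - 1) * fbern b = fvar R.
Proof. by move=> /delta_fexpB1 delta_b; apply: delta_fdivK. Qed.

Lemma fdilate_fexp c b : fdilate c (fexp b) = fexp (c * b).
Proof. by apply: fpsP => n; rewrite /= exprMn mulrA. Qed.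

Lemma fdilate_fbern c b : c \is a GRing.unit -> b \is a GRing.unit ->
  fdilate c (fbern b) = fconst c * fbern (c * b).
Proof.
move=> uc ub; have ucb : c * b \is a GRing.unit by rewrite unitrM uc.
apply: (delta_series_lreg (delta_fexpB1 ucb)).
rewrite mulrCA fbernP // -fdilate_fexp -(rmorph1 (fdilate c)) -rmorphB -rmorphM.
by rewrite fbernP //= fdilate_var.
Qed.

Definition fbern_dlog b : fps R := 1 + fconst b * fbern (- b).

Hypothesis natS_unit : forall n, n.+1%:R \is a @GRing.unit R.

Lemma fbernN b : b \is a GRing.unit -> fbern (- b) = - (fexp b * fbern b).
Proof.
move=> ub; apply: delta_fdiv_unique; first by apply: delta_fexpB1; rewrite unitrN.
rewrite -[RHS](fbernP ub); have expMN := fexpMN natS_unit b.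
by ring: expMN.
Qed.

Lemma ftheta_fbern b : b \is a GRing.unit ->
  ftheta (fbern b) = fbern_dlog b * fbern b.
Proof.
move=> ub; apply: (delta_series_lreg (delta_fexpB1 ub)).
have := congr1 (@ftheta R) (fbernP ub).
rewrite fthetaM raddfB /= ftheta1 subr0 ftheta_fexp // ftheta_var => theta_def.
rewrite -[LHS](addKr (fconst b * fvar R * fexp b * fbern b)) theta_def.
rewrite /fbern_dlog fbernN //.
by rewrite -(fbernP ub); ring.
Qed.

End BernoulliSeries.

Section MapBernoulliSeries.
Variables (R S : comUnitRingType) (h : {rmorphism R -> S}).
Hypothesis natS_unit : forall n, n.+1%:R \is a @GRing.unit R.

Lemma map_fps_fexp b : map_fps h (fexp b) = fexp (h b).
Proof.
apply: fpsP => n; rewrite [LHS]/= rmorphM rmorphXn.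
by rewrite rmorphV ?fact_unit // rmorph_nat.
Qed.

Lemma map_fps_fbern b : b \is a GRing.unit -> map_fps h (fbern b) = fbern (h b).
Proof.
move=> ub; apply/esym/delta_fdiv_unique; first exact/delta_fexpB1/rmorph_unit.
rewrite -map_fps_fexp -(rmorph1 (map_fps h)) -rmorphB -rmorphM /= fbernP //.
exact: map_fps_var.
Qed.

End MapBernoulliSeries.

Section PolyBernoulliSeries.
Variable R : comUnitRingType.
Hypothesis natS_unit : forall n, n.+1%:R \is a @GRing.unit R.
Implicit Types k : int.

Definition polyB_arg : fps R := 1 - fexp (-1).

Definition fpolyB k : fps R := fdiv (fcomp (fLi R k) polyB_arg) polyB_arg.

Lemma delta_polyB_arg : delta_series polyB_arg.
Proof.
split; rewrite fcoefB ?fexp_coef0 ?subrr //.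
by rewrite fexp_coef1 sub0r opprK unitr1.
Qed.

Lemma fpolyBP k : polyB_arg * fpolyB k = fcomp (fLi R k) polyB_arg.
Proof.
apply: delta_fdivK; first exact: delta_polyB_arg.
by rewrite /= big_ord1 mul0r.
Qed.

Lemma ftheta_polyB_arg : ftheta polyB_arg = fbern 1 * polyB_arg.
Proof.
rewrite raddfB /= ftheta1 ftheta_fexp // sub0r rmorphN1 -(fbernP (unitr1 R)).
have expMN := fexpMN natS_unit 1.
by rewrite /polyB_arg; ring: expMN.
Qed.

Lemma ftheta_fpolyB k : ftheta (fpolyB k) = fbern 1 * (fpolyB (k - 1) - fpolyB k).
Proof.
have delta_u := delta_polyB_arg; apply: (delta_series_lreg delta_u).
have := ftheta_comp (fLi R k) (proj1 delta_u).
rewrite ftheta_fLi // -!fpolyBP fthetaM -!mulrA.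
move/(delta_series_lreg delta_u) => theta_def.
rewrite -[LHS](addKr (ftheta polyB_arg * fpolyB k)) theta_def ftheta_polyB_arg.
by ring.
Qed.

End PolyBernoulliSeries.

Section BarnesRecurrence.
Variable C : fieldType.
Hypothesis pchar0 : [pchar C] =i pred0.
Implicit Types (b : C) (k : int).

Lemma natS_unit n : n.+1%:R \is a @GRing.unit C.
Proof. by rewrite unitfE; move/pcharf0P: pchar0 => ->. Qed.

Lemma polyC_unit b : b != 0 -> b%:P \is a @GRing.unit {poly C}.
Proof. by move=> b_neq0; rewrite rmorph_unit ?unitfE. Qed.

Lemma poly_natS_unit n : n.+1%:R \is a @GRing.unit {poly C}.
Proof. by rewrite -polyC_natr rmorph_unit ?natS_unit. Qed.

Lemma bernoulli0 : bernoulli C 0 = 1.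
Proof.
have := congr1 (fun f : fps C => f 1%N) (bernoulliP C).
rewrite fcoefM big_ord_recl big_ord1 fcoefB fexp_coef0 subrr mul0r add0r.
by rewrite fcoefB fexp_coef1 subr0 /bernoulli !mul1r.
Qed.

Lemma fcoef_fbern b n : b != 0 ->
  b * fbern b n = b ^+ n * (bernoulli C n / n`!%:R).
Proof.
rewrite -unitfE => ub; rewrite -fcoefCM -[in fbern b](mulr1 b).
rewrite -fdilate_fbern ?unitr1 // /bernoulli mulrAC divrr ?mul1r //.
exact: fact_unit natS_unit n.
Qed.

Lemma fcoef_fbern_dlog b n : b != 0 ->
  fbern_dlog b%:P n
  = (n == 0%N)%:R - ((- b) ^+ n * (bernoulli C n / n`!%:R))%:P.
Proof.
rewrite -oppr_eq0 => b_neq0; rewrite fcoefD fcoef1 fcoefCM -polyCN.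
rewrite -(map_fps_fbern _ natS_unit) ?unitfE // [map_fps _ _ _]/= -polyCM.
by rewrite -fcoef_fbern // mulNr polyCN opprK.
Qed.

Lemma fcoef0_sum_fbern_dlog (s : seq C) : 0 \notin s ->
  (\sum_(b <- s) fbern_dlog b%:P) 0%N = 0.
Proof.
move=> s_neq0; rewrite fcoef_sum big1_seq // => b /andP[_ b_in_s].
rewrite fcoef_fbern_dlog ?(memPn s_neq0) //.
by rewrite bernoulli0 expr0 divr1 mulr1 subrr.
Qed.

Lemma fcoefS_sum_fbern_dlog (s : seq C) n : 0 \notin s ->
  (\sum_(b <- s) fbern_dlog b%:P) n.+1
  = ((-1) ^+ n * (bernoulli C n.+1 / n.+1`!%:R) * \sum_(b <- s) b ^+ n.+1)%:P.
Proof.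
move=> s_neq0; rewrite fcoef_sum mulr_sumr rmorph_sum !big_seq.
apply: eq_bigr => b b_in_s; rewrite fcoef_fbern_dlog ?(memPn s_neq0) // sub0r.
by rewrite -polyCN [(- b) ^+ _]exprNn exprS; congr _%:P; ring.
Qed.

Lemma barnesSE r k (a : r.-tuple C) n :
  barnesS k a n = n`!%:R *: barnesS_genfun k a n.
Proof. by rewrite scaler_nat -mulr_natl. Qed.

Lemma barnesS_genfunE r k (a : r.-tuple C) : 0 \notin a ->
  barnesS_genfun k a = (\prod_(b <- a) fbern b%:P) * fpolyB {poly C} k * fexp 'X.
Proof.
move=> a_neq0; rewrite /barnesS_genfun fdiv_prod ?big_tuple // => j.
by apply/delta_fexpB1/polyC_unit; rewrite (memPn a_neq0) ?mem_tnth.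
Qed.

Lemma barnesS_genfun_rcons r k (a : r.-tuple C) b : b != 0 -> 0 \notin a ->
  barnesS_genfun k (rcons_tuple a b) = fbern b%:P * barnesS_genfun k a.
Proof.
move=> b_neq0 a_neq0; rewrite !barnesS_genfunE //; last first.
  by rewrite mem_rcons inE negb_or eq_sym b_neq0.
by rewrite big_rcons /=; ring.
Qed.

Lemma ftheta_prod_fbern (s : seq C) : 0 \notin s ->
  ftheta (\prod_(b <- s) fbern b%:P)
  = (\sum_(b <- s) fbern_dlog b%:P) * \prod_(b <- s) fbern b%:P.
Proof.
move=> s_neq0; rewrite !big_seq; apply: ftheta_prod => b b_in_s.
apply: (ftheta_fbern poly_natS_unit); apply: polyC_unit.
by rewrite (memPn s_neq0).
Qed.

Lemma ftheta_barnesS_genfun r k (a : r.-tuple C) : 0 \notin a ->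
  ftheta (barnesS_genfun k a)
  = fvar _ * (fconst 'X * barnesS_genfun k a)
    + (\sum_(b <- a) fbern_dlog b%:P) * barnesS_genfun k a
    + barnesS_genfun (k - 1) (rcons_tuple a 1)
    - barnesS_genfun k (rcons_tuple a 1).
Proof.
move=> a_neq0; rewrite !barnesS_genfun_rcons ?oner_neq0 // !barnesS_genfunE //.
rewrite 2!fthetaM ftheta_prod_fbern // (ftheta_fpolyB poly_natS_unit).
by rewrite (ftheta_fexp poly_natS_unit); ring.
Qed.

Lemma barnesS_genfun_rec r k (a : r.-tuple C) n : 0 \notin a ->
  n.+1%:R *: barnesS_genfun k a n.+1
  = 'X * barnesS_genfun k a n
    + \sum_(m < n.+1)
        ((-1) ^+ m * (bernoulli C m.+1 / m.+1`!%:R) * \sum_(b <- a) b ^+ m.+1)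
        *: barnesS_genfun k a (n - m)%N
    + barnesS_genfun (k - 1) (rcons_tuple a 1) n.+1
    - barnesS_genfun k (rcons_tuple a 1) n.+1.
Proof.
move=> a_neq0; rewrite scaler_nat -mulr_natl.
rewrite -[LHS]/(ftheta (barnesS_genfun k a) n.+1) ftheta_barnesS_genfun //.
rewrite fcoefB !fcoefD fcoef_varM fcoefCM; congr (_ + _ + _ - _).
rewrite fcoefM big_ord_recl fcoef0_sum_fbern_dlog // mul0r add0r.
apply: eq_bigr => m _; rewrite lift0 subSS -mul_polyC.
by rewrite fcoefS_sum_fbern_dlog.
Qed.

Lemma barnesS_recurrence r k (a : r.-tuple C) n : 0 \notin a ->
  barnesS k a n.+1
  = 'X * barnesS k a n
    + \sum_(m < n.+1)
        ((-1) ^+ m * 'C(n, m)%:R * bernoulli C m.+1 / m.+1%:R)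
        *: ((\sum_(b <- a) b ^+ m.+1) *: barnesS k a (n - m))
    + n.+1%:R^-1 *: barnesS (k - 1) (rcons_tuple a 1) n.+1
    - n.+1%:R^-1 *: barnesS k (rcons_tuple a 1) n.+1.
Proof.
move=> a_neq0; rewrite !barnesSE factS natrM.
rewrite !scalerA mulKr ?natS_unit // mulrC -scalerA barnesS_genfun_rec //.
rewrite !scalerBr !scalerDr scalerAr; congr (_ + _ + _ - _).
rewrite scaler_sumr; apply: eq_bigr => -[m /= lt_mn] _.
rewrite barnesSE !scalerA; congr (_ *: _).
rewrite -(bin_fact (_ : (m <= n)%N)) // factS !natrM.
field; by rewrite nat1r -!unitfE !(fact_unit natS_unit) natS_unit.
Qed.

End BarnesRecurrence.

Theorem theorem4 (R : realType) (r : nat) (k : int) (a : r.-tuple R[i]) (n : nat)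
    (hr : (0 < r)%N) (ha : forall j : 'I_r, tnth a j != 0) (hn : (1 <= n)%N) :
  barnesS k a n =
    'X * barnesS k a (n - 1)
    + \sum_(1 <= m < n.+1)
        ((-1) ^+ (m - 1) * 'C(n - 1, m - 1)%:R * bernoulli R[i] m / m%:R) *:
        (\sum_(j < r) (tnth a j) ^+ m *: barnesS k a (n - m))
    + n%:R^-1 *: barnesS (k - 1) (rcons_tuple a 1) n
    - n%:R^-1 *: barnesS k (rcons_tuple a 1) n.
Proof.
have a_neq0 : 0 \notin a.
  by apply/tnthP => -[j a_j]; move: (ha j); rewrite -a_j eqxx.
case: n hn => // n _; rewrite subn1 big_add1 big_mkord.
rewrite (barnesS_recurrence (Num.Theory.pchar_num _)) //; congr (_ + _ + _ - _).
by apply: eq_bigr => m _; rewrite subn1 subSS -scaler_suml big_tuple.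
Qed.
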